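(* For every nonnegative integer $n$ and every integer $k\geq 2$, \begin{align*} \overline{a}_5(20n+6) &\equiv 0 \pmod{10},\\ \overline{a}_5(20n+14) &\equiv 0 \pmod{10},\\ 4\overline{a}_5(5^{k}n) &\equiv 5\overline{a}_5(n) - \overline{a}_5(5n) \pmod{5^k}. \end{align*}
   Context: For $j\ge1$ let $f_j:=\prod_{k\ge 1}(1-q^{jk})$ (for $|q|<1$, or as a formal power series). Let $\varphi(-q):=\sum_{n=-\infty}^{\infty}(-1)^n q^{n^2}=f_1^2/f_2$, so that $\varphi(-q^5)=f_5^2/f_{10}$. The integers $\overline{a}_5(n)$ are defined by $$\sum_{n=0}^\infty \overline{a}_5(n)q^n=\frac{\varphi^5(-q^5)}{\varphi(-q)}=1+2q+4q^2+8q^3+14q^4+14q^5+20q^6+24q^7+\cdots .$$ *)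

(* Defs.v *)
From HB Require Import structures.
From mathcomp Require Import all_boot all_order all_algebra.
From mathcomp Require Import boolp.
Set Implicit Arguments.
Unset Strict Implicit.
Unset Printing Implicit Defensive.
Import GRing.Theory.
Local Open Scope ring_scope.

(* Formal power series in q over R.  The coefficient sequence is wrapped in a
   record because functions already carry a pointwise ring structure. *)
Record fps (R : Type) := Fps { fcoef : nat -> R }.

Notation "s .[q^ n ]" := (fcoef s n) (at level 2, format "s .[q^ n ]").

Lemma fpsP (R : Type) (s t : fps R) :
  (forall n, s.[q^n] = t.[q^n]) <-> s = t.
Proof.
split=> [|-> //]; case: s => s; case: t => t /= st.
by congr Fps; apply: funext.
Qed.

HB.instance Definition _ (R : Type) := gen_eqMixin (fps R).
HB.instance Definition _ (R : Type) := gen_choiceMixin (fps R).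

Section Zmodule.
Variable R : zmodType.
Implicit Types s t : fps R.

Definition fps0 : fps R := Fps (fun=> 0).
Definition fps_opp s := Fps (fun n => - s.[q^n]).
Definition fps_add s t := Fps (fun n => s.[q^n] + t.[q^n]).

Lemma fps_addA : associative fps_add.
Proof. by move=> s t u; apply/fpsP => n; rewrite /= addrA. Qed.

Lemma fps_addC : commutative fps_add.
Proof. by move=> s t; apply/fpsP => n; rewrite /= addrC. Qed.

Lemma fps_add0 : left_id fps0 fps_add.
Proof. by move=> s; apply/fpsP => n; rewrite /= add0r. Qed.

Lemma fps_addN : left_inverse fps0 fps_opp fps_add.
Proof. by move=> s; apply/fpsP => n; rewrite /= addNr. Qed.

HB.instance Definition _ :=
  GRing.isZmodule.Build (fps R) fps_addA fps_addC fps_add0 fps_addN.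

End Zmodule.

Section ComRing.
Variable R : comNzRingType.
Implicit Types s t : fps R.

Definition fps1 : fps R := Fps (fun n => (n == 0)%:R).
Definition fps_mul s t :=
  Fps (fun n => \sum_(i < n.+1) s.[q^i] * t.[q^(n - i)]).

Let trunc N s : {poly R} := \poly_(i < N) s.[q^i].

Let trunc_mul N s t n : (n < N)%N ->
  (fps_mul s t).[q^n] = (trunc N s * trunc N t)`_n.
Proof.
move=> ltnN; rewrite coefM; apply: eq_bigr => i _.
by rewrite !coef_poly (leq_ltn_trans (leq_ord i)) // (leq_ltn_trans (leq_subr _ _)).
Qed.

Lemma fps_mulC : commutative fps_mul.
Proof.
by move=> s t; apply/fpsP => n; rewrite !(trunc_mul _ _ (ltnSn n)) mulrC.
Qed.

Lemma fps_mulA : associative fps_mul.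
Proof.
move=> s t u; apply/fpsP => n.
transitivity (trunc n.+1 s * (trunc n.+1 t * trunc n.+1 u))`_n.
  rewrite coefM; apply: eq_bigr => i _.
  by rewrite -trunc_mul ?ltnS ?leq_subr // coef_poly ltn_ord.
rewrite mulrA coefM; apply: eq_bigr => i _.
by rewrite -trunc_mul ?ltn_ord // coef_poly ltnS leq_subr.
Qed.

Lemma fps_mul1 : left_id fps1 fps_mul.
Proof.
move=> s; apply/fpsP => n /=; rewrite big_ord_recl /= mul1r subn0.
by rewrite big1 ?addr0 // => i _; rewrite mul0r.
Qed.

Lemma fps_mulDl : left_distributive fps_mul (@fps_add R).
Proof.
move=> s t u; apply/fpsP => n /=; rewrite -big_split.
by apply: eq_bigr => i _; rewrite mulrDl.
Qed.

Lemma fps1_neq0 : fps1 != 0.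
Proof. by apply/eqP => /fpsP/(_ 0) /eqP; rewrite /= oner_eq0. Qed.

HB.instance Definition _ := GRing.Zmodule_isComNzRing.Build (fps R)
  fps_mulA fps_mulC fps_mul1 fps_mulDl fps1_neq0.

Lemma fcoefM s t n :
  (s * t).[q^n] = \sum_(i < n.+1) s.[q^i] * t.[q^(n - i)].
Proof. by []. Qed.

Lemma fcoef1 n : (1 : fps R).[q^n] = (n == 0)%:R.
Proof. by []. Qed.

End ComRing.

Section UnitRing.
Variable R : comUnitRingType.
Implicit Types s t : fps R.

(* The first n coefficients of 1 / s, each computed from the previous ones. *)
Fixpoint fps_inv_seq s n : seq R :=
  if n is m.+1 then
    let r := fps_inv_seq s m in
    rcons r (s.[q^0]^-1 * ((m == 0)%:R - \sum_(i < m) s.[q^(m - i)] * r`_i))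
  else [::].

Definition fps_unit : pred (fps R) := fun s => s.[q^0] \is a GRing.unit.
Definition fps_inv s : fps R :=
  if fps_unit s then Fps (fun n => (fps_inv_seq s n.+1)`_n) else s.

Let size_inv_seq s n : size (fps_inv_seq s n) = n.
Proof. by elim: n => //= n IHn; rewrite size_rcons IHn. Qed.

Let nth_inv_seq s n i : (i < n)%N ->
  (fps_inv_seq s n)`_i = (fps_inv_seq s i.+1)`_i.
Proof.
elim: n => // n IHn; rewrite ltnS leq_eqVlt => /predU1P[-> //|ltin].
by rewrite {1}/fps_inv_seq -/fps_inv_seq nth_rcons size_inv_seq ltin IHn.
Qed.

Lemma fps_mulV : {in fps_unit, left_inverse 1 fps_inv *%R}.
Proof.
move=> s Us; apply/fpsP => n; rewrite fcoefM fcoef1 /fps_inv.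
rewrite [fps_unit s]Us big_ord_recr /= subnn nth_rcons size_inv_seq ltnn eqxx.
rewrite [X in _ + X]mulrC mulrA mulrV // mul1r addrC.
under [X in _ + X = _]eq_bigr => i _.
  rewrite -[rcons _ _]/(fps_inv_seq s i.+1) -(nth_inv_seq _ (ltn_ord i)) mulrC.
  over.
exact: subrK.
Qed.

Lemma fps_unitP s t : t * s = 1 -> fps_unit s.
Proof.
move=> /fpsP/(_ 0); rewrite fcoefM big_ord1 /= => ts1.
by apply/unitrPr; exists t.[q^0]; rewrite mulrC.
Qed.

Lemma fps_inv_out : {in [predC fps_unit], fps_inv =1 id}.
Proof. by move=> s /negbTE Us; rewrite /fps_inv [fps_unit s]Us. Qed.

HB.instance Definition _ := GRing.ComNzRing_hasMulInverse.Build (fps R)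
  fps_mulV fps_unitP fps_inv_out.

End UnitRing.

(* The substitution q |-> q ^ d, for d > 0. *)
Definition fps_subst (R : zmodType) (d : nat) (s : fps R) : fps R :=
  Fps (fun n => if (d %| n)%N then s.[q^(n %/ d)] else 0).

(* phi(-q) = \sum_(j in Z) (-1)^j q^(j^2).  The integers j with j^2 = n all lie
   in [-n, n]; they are enumerated as j = i - n with 0 <= i <= 2n. *)
Definition phi_neg : fps int :=
  Fps (fun n => \sum_(i < n.*2.+1 | (i%:Z - n%:Z) ^+ 2 == n%:Z)
                   (-1) ^ (i%:Z - n%:Z)).

(* phi(-q^5)^5 / phi(-q) *)
Definition a5bar_gen : fps int := fps_subst 5 phi_neg ^+ 5 / phi_neg.

Definition a5bar (n : nat) : int := a5bar_gen.[q^n].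

Lemma phi_neg_unit : phi_neg \is a GRing.unit.
Proof.
rewrite [_ \is a _]/(phi_neg.[q^0] \is a GRing.unit) /=.
by rewrite big_mkcond big_ord1.
Qed.

(* The quotient above is a genuine one. *)
Lemma a5bar_genE : a5bar_gen * phi_neg = fps_subst 5 phi_neg ^+ 5.
Proof. by rewrite divrK ?phi_neg_unit. Qed.

(* Main.v *)
Require Import Defs.
From mathcomp Require Import all_boot all_order all_algebra.
From mathcomp Require Import boolp classical_sets functions cardinality fsbigop.
From mathcomp Require Import zify ring.
Import Order.TTheory GRing.Theory Num.Theory.
Set Implicit Arguments.
Unset Strict Implicit.
Unset Printing Implicit Defensive.
Local Open Scope classical_set_scope.
Local Open Scope ring_scope.

(** Write G for the generating series and U for the operator keeping the
    coefficients of index 5n.  The 5-dissection of phi(-q) expresses phi(-q) through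
    the theta series a, b, c = sum (-1)^n q^(5n^2+jn) with j = 0, 2, 4.  The product
    of the five conjugates of phi(-q) under q -> zeta q is a polynomial in these,
    equal to phi(-q)^6 / a up to the substitution q -> q^5; this inverts phi(-q) and
    gives U G = 5 G - 5 a^3 phi(-q) + a phi(-q)^3.  Since U also preserves the span of
    the three series on the right, U^2 G = 6 U G - 5 G, and the congruence modulo 5^k
    follows by solving this recurrence.

    Modulo 5, 1 / phi(-q) is a product of positive powers of theta series times
    a series in q^20, and the part of G supported on exponents 4n + 2 becomes
    phi(-q^2)^2 psi(q^2) times a combination of theta series whose exponents are 0 or 2
    modulo 5.  By Jacobi, phi(-q)^2 psi(q) = sum (4n+1) q^(2n^2+n), so modulo 5 the first
    factor also has only exponents 0 or 2 modulo 5, and no exponent of the product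
    is 1 or 3.  Everything modulo 2 follows from phi(-q) = 1.

    All theta identities are obtained by splitting lattice sums into cosets. *)

(** * Coefficients, sections and substitutions of power series *)

Notation "s ∘q^ d" := (fps_subst d s) (at level 2, d at level 1, format "s ∘q^ d").

Definition fpsq : fps int := Fps (fun n => (n == 1)%:R).
Notation "'q" := fpsq.

(** [sect 5 0] is the operator U. *)
Definition sect (d r : nat) (s : fps int) : fps int :=
  Fps (fun n => s.[q^(d * n + r)%N]).

Implicit Types s t u : fps int.

Lemma fcoefD s t n : (s + t).[q^n] = s.[q^n] + t.[q^n].
Proof. by []. Qed.

Lemma fcoefN s n : (- s).[q^n] = - s.[q^n].
Proof. by []. Qed.

Lemma fcoef0 n : (0 : fps int).[q^n] = 0.
Proof. by []. Qed.

Lemma fcoefMz (c : int) s n : (c%:~R * s).[q^n] = c * s.[q^n].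
Proof.
rewrite mulrzl.
have nat_case m : (s *+ m).[q^n] = m%:Z * s.[q^n].
  elim: m => [|m IH]; first by rewrite mulr0n mul0r.
  by rewrite mulrS fcoefD IH -add1n PoszD mulrDl mul1r.
case: c => m; first exact: nat_case.
by rewrite NegzE mulrNz fcoefN nat_case mulNr.
Qed.

Lemma fcoefMq k s n : ('q ^+ k * s).[q^n] = if (k <= n)%N then s.[q^(n - k)] else 0.
Proof.
elim: k s n => [|k IH] s n; first by rewrite expr0 mul1r subn0.
rewrite exprSr -mulrA IH; case: (leqP k n) => [lekn|ltnk]; last first.
  by rewrite ifF //; lia.
have qM m : ('q * s).[q^m] = if (0 < m)%N then s.[q^m.-1] else 0.
  case: m => [|m]; first by rewrite fcoefM big_ord1 mul0r.
  rewrite fcoefM big_ord_recl mul0r add0r big_ord_recl /= mul1r big1.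
    by rewrite addr0 /bump /= subSS subn0.
  by move=> i _; rewrite mul0r.
by rewrite qM subn_gt0; case: ifP => // _; congr fcoef; lia.
Qed.

(** Only indices [d * k] contribute to the Cauchy product, and [r < d] makes [d * k <= d * n + r]
    equivalent to [k <= n]. *)
Lemma fcoefM_subst (d r n : nat) s t : (r < d)%N ->
  (s * t∘q^d).[q^(d * n + r)] = \sum_(k < n.+1) s.[q^(d * (n - k) + r)] * t.[q^k].
Proof.
move=> ltrd; have d_gt0 : (0 < d)%N by lia.
have dn (k : nat) : (k < n.+1)%N -> (d * k < (d * n + r).+1)%N by nia.
have nd (i : nat) : (i < (d * n + r).+1)%N -> (i %/ d < n.+1)%N.
  by move=> lti; rewrite ltnS -ltnS ltn_divLR //; nia.
rewrite mulrC fcoefM (bigID (fun i : 'I_ _ => (d %| i)%N)) /= [X in _ + X]big1 ?addr0.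
  rewrite (reindex_onto (fun k : 'I_n.+1 => inord (d * k)%N : 'I_(d * n + r).+1)
                        (fun i : 'I_(d * n + r).+1 => inord (i %/ d)%N : 'I_n.+1)) /=.
    apply: eq_big => k.
      rewrite inordK ?dn // dvdn_mulr //= mulKn //; apply/eqP/val_inj.
      by rewrite /= inordK.
    rewrite inordK ?dn // => _; rewrite dvdn_mulr // mulKn // mulrC; congr (fcoef _ _ * _).
    have := ltn_ord k; nia.
  move=> i di; apply/val_inj; rewrite /= inordK.
    by rewrite inordK ?nd // mulnC divnK.
  by rewrite inordK ?nd // mulnC divnK.
by move=> i /negbTE ->; rewrite mul0r.
Qed.

Lemma substE d s n : (0 < d)%N -> (s∘q^d).[q^(d * n)] = s.[q^n].
Proof. by move=> d_gt0; rewrite /= dvdn_mulr // mulKn. Qed.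

Lemma substE0 d r s n : (0 < r < d)%N -> (s∘q^d).[q^(d * n + r)] = 0.
Proof.
move=> rd; rewrite /= ifF //; apply/negbTE.
by rewrite dvdn_addr ?dvdn_mulr // gtnNdvd //; lia.
Qed.

Lemma sectE d r s n : (sect d r s).[q^n] = s.[q^(d * n + r)].
Proof. by []. Qed.

Lemma fps_eq_sect d s t : (0 < d)%N ->
  (forall r, (r < d)%N -> sect d r s = sect d r t) -> s = t.
Proof.
move=> d_gt0 st; apply/fpsP => n; rewrite (divn_eq n d) mulnC.
by have /fpsP/(_ (n %/ d)%N) := st _ (ltn_pmod n d_gt0).
Qed.

(** Series in q^d act as scalars for the section operators, so a section can be computed after
    clearing a denominator in q^d. *)
Lemma sectM_subst d r s t : (r < d)%N -> sect d r (s * t∘q^d) = sect d r s * t.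
Proof.
move=> ltrd; apply/fpsP => n; rewrite sectE fcoefM_subst // mulrC fcoefM.
by apply: eq_bigr => k _; rewrite mulrC.
Qed.

Lemma sectD d r s t : sect d r (s + t) = sect d r s + sect d r t.
Proof. exact/fpsP. Qed.

Lemma sectN d r s : sect d r (- s) = - sect d r s.
Proof. exact/fpsP. Qed.

Lemma sect_subst d s : (0 < d)%N -> sect d 0 s∘q^d = s.
Proof. by move=> d0; apply/fpsP => n; rewrite sectE addn0 substE. Qed.

Lemma sect_subst0 d r s : (0 < r < d)%N -> sect d r s∘q^d = 0.
Proof. by move=> rd; apply/fpsP => n; rewrite sectE substE0. Qed.

Lemma substM d s t : (0 < d)%N -> (s * t)∘q^d = s∘q^d * t∘q^d.
Proof.
move=> d0; apply: (fps_eq_sect d0) => -[|r] rd; rewrite sectM_subst //.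
  by rewrite !sect_subst.
by rewrite !sect_subst0 // mul0r.
Qed.

Lemma substD d s t : (s + t)∘q^d = s∘q^d + t∘q^d.
Proof. by apply/fpsP => n; rewrite fcoefD /=; case: ifP. Qed.

Lemma substN d s : (- s)∘q^d = - s∘q^d.
Proof. by apply/fpsP => n; rewrite fcoefN /=; case: ifP. Qed.

Lemma subst1 d : (0 < d)%N -> (1 : fps int)∘q^d = 1.
Proof.
move=> d0; apply/fpsP => -[|n]; rewrite fcoef1 /= ?dvdn0 ?div0n //.
by case: ifP => // dn; rewrite eqn0Ngt divn_gt0 // dvdn_leq.
Qed.

Lemma subst_nat d m : (0 < d)%N -> (m%:R : fps int)∘q^d = m%:R.
Proof.
move=> d0; elim: m => [|m IH]; first by apply/fpsP => n /=; case: ifP.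
by rewrite -addn1 natrD substD IH subst1.
Qed.

Lemma substX d s k : (0 < d)%N -> (s ^+ k)∘q^d = s∘q^d ^+ k.
Proof.
by move=> d0; elim: k => [|k IH]; rewrite ?expr0 ?subst1 // !exprS substM ?IH.
Qed.

Lemma subst_subst d1 d2 s : (0 < d1)%N -> (0 < d2)%N ->
  s∘q^d1∘q^d2 = s∘q^(d1 * d2).
Proof.
move=> d10 d20; apply/fpsP => n /=; have [dn|ndn] := boolP (d2 %| n)%N.
  by rewrite dvdn_divRL // divnMA [in RHS]divnAC.
by rewrite ifF //; apply: contraNF ndn => /(dvdn_trans _) -> //; rewrite dvdn_mull.
Qed.

Lemma subst_q d : (0 < d)%N -> 'q∘q^d = 'q ^+ d.
Proof.
move=> d0; apply/fpsP => n; rewrite -[_ ^+ _]mulr1 fcoefMq fcoef1 /=.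
have [/dvdnP[m ->]|ndn] := boolP (d %| n)%N.
  rewrite mulnK //; case: m => [|[|m]]; rewrite ?mul0n ?mul1n ?leqnn ?subnn //=.
    by rewrite leqNgt d0.
  by case: ifP => //= _; rewrite (_ : (_ == 0%N) = false) //; nia.
case: leqP => // le_dn; rewrite (_ : (_ == 0%N) = false) //.
by apply: contraNF ndn => /eqP dn; rewrite (_ : n = d) //; lia.
Qed.

(** * Weighted theta series over arbitrary index types *)

Lemma fsbig_fibre (I : choiceType) (A : set I) (F : I -> int) (m : nat) (g : I -> nat) :
    finite_set A -> (forall i, A i -> (g i < m)%N) ->
  \sum_(i \in A) F i = \sum_(k < m) \sum_(i \in A `&` [set i | g i = k]) F i.
Proof.
move=> finA gm; under [RHS]eq_bigr do rewrite fsbig_mkcondr fsbig_finite //.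
rewrite fsbig_finite // exchange_big /=; apply: eq_big_seq => i.
rewrite in_fset_set // inE => /gm gim.
rewrite (bigD1 (Ordinal gim)) //= mem_set // big1 ?addr0 // => k kgi.
by rewrite memNset //= => gik; move/eqP: kgi; apply; apply/val_inj.
Qed.

(** Indices of negative exponent are dropped, and a coefficient defaults to 0 when infinitely many
    nonzero weights share its exponent; hence [locally_finite] below. *)
Definition theta (I : choiceType) (e w : I -> int) : fps int :=
  Fps (fun n => \sum_(i \in [set i | e i = n%:Z]) w i).

Definition locally_finite (I : choiceType) (e : I -> int) :=
  forall n : nat, finite_set [set i | e i = n%:Z].

Lemma eq_theta (I : choiceType) (e e' w w' : I -> int) :
  e =1 e' -> w =1 w' -> theta e w = theta e' w'.
Proof. by move=> /funext -> /funext ->. Qed.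

Lemma thetaMl (I : choiceType) (e w : I -> int) (c : int) :
  theta e (fun i => c * w i) = c%:~R * theta e w.
Proof. by apply/fpsP => n; rewrite fcoefMz mulr_fsumr. Qed.

Lemma thetaN (I : choiceType) (e w : I -> int) :
  theta e (fun i => - w i) = - theta e w.
Proof.
rewrite -mulN1r -[-1]/((-1)%:~R) -thetaMl.
by apply: eq_theta => // i; rewrite mulN1r.
Qed.

Lemma thetaD (I : choiceType) (e w w' : I -> int) : locally_finite e ->
  theta e (fun i => w i + w' i) = theta e w + theta e w'.
Proof. by move=> fe; apply/fpsP => n; rewrite fcoefD [LHS]fsbig_split. Qed.

Lemma theta_reindex (I J : choiceType) (h : I -> J) (e w : J -> int) :
  bijective h -> theta e w = theta (e \o h) (w \o h).
Proof.
move=> [g hK gK]; apply/fpsP => n; apply: reindex_fsbig; split=> //.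
  by move=> i j _ _ /(can_inj hK).
by move=> j /= ej; exists (g j); rewrite /= gK.
Qed.

Lemma theta_subst (I : choiceType) (d : nat) (e w : I -> int) : (0 < d)%N ->
  theta (fun i => d%:Z * e i) w = (theta e w)∘q^d.
Proof.
move=> d0; apply/fpsP => n; rewrite /=; case: ifP => [/dvdnP[k ->]|ndn].
  rewrite mulnK //; congr (\big[_/_]_(i \in _) _); apply/seteqP.
  by split=> i /=; rewrite PoszM; nia.
rewrite fsbig1 // => i /= dei; move: ndn; suff -> : (d %| n)%N by [].
by apply/dvdnP; exists `|e i|%N; nia.
Qed.

(** Nonnegativity of [e] ensures that no dropped index of negative exponent becomes visible after
    the shift. *)
Lemma theta_shift (I : choiceType) (k : nat) (e w : I -> int) :
  (forall i, 0 <= e i) -> theta (fun i => e i + k%:Z) w = 'q ^+ k * theta e w.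
Proof.
move=> e0; apply/fpsP => n; rewrite fcoefMq /=; case: leqP => kn.
  congr (\big[_/_]_(i \in _) _); apply/seteqP.
  by split=> i /=; have := e0 i; lia.
by rewrite fsbig1 // => i /=; have := e0 i; lia.
Qed.

Lemma locally_finiteD (I J : choiceType) (e : I -> int) (f : J -> int) :
    locally_finite e -> locally_finite f ->
    (forall i, 0 <= e i) -> (forall j, 0 <= f j) ->
  locally_finite (fun p : I * J => e p.1 + f p.2).
Proof.
move=> fe ff e0 f0 n.
apply: (@sub_finite_set _ _ (\bigcup_(k in `I_n.+1)
  ([set i | e i = k] `*` [set j | f j = (n - k)%N]))).
  move=> p /= Ap; have := e0 p.1; have := f0 p.2.
  by exists `|e p.1|%N; [rewrite /=; lia | split=> /=; lia].
by apply: bigcup_finite => // k _; apply: finite_setX.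
Qed.

Lemma thetaM (I J : choiceType) (e w : I -> int) (f v : J -> int) :
    locally_finite e -> locally_finite f ->
    (forall i, 0 <= e i) -> (forall j, 0 <= f j) ->
  theta e w * theta f v =
    theta (fun p : I * J => e p.1 + f p.2) (fun p => w p.1 * v p.2).
Proof.
move=> fe ff e0 f0; apply/fpsP => n; rewrite fcoefM /=.
set A := [set p : I * J | _].
have fibre (k : nat) : (k < n.+1)%N ->
    A `&` [set p | `|e p.1|%N = k] = [set i | e i = k] `*` [set j | f j = (n - k)%N].
  move=> kn; apply/seteqP; split=> -[i j] /=; have := e0 i; have := f0 j; rewrite /A /=; lia.
have finA : finite_set A by apply: locally_finiteD.
rewrite (@fsbig_fibre _ _ _ n.+1 (fun p => `|e p.1|%N)) //; last first.
  by move=> p Ap; have := e0 p.1; have := f0 p.2; have : e p.1 + f p.2 = n by []; lia.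
apply: eq_bigr => k _; rewrite fibre // -(@pair_fsbig _ _ _ _ _ _ _ (fun i j => w i * v j)) //.
by rewrite mulr_fsuml; apply: eq_fsbigr => i _; rewrite mulr_fsumr.
Qed.

(** Coset decomposition: [h k] parametrizes the k-th class and [g] names the class of an index. The
    dissections and the product formulas are instances with affine [h k]. *)
Lemma theta_split (I J : choiceType) (m : nat) (h : nat -> J -> I) (g : I -> nat)
    (e w : I -> int) :
    locally_finite e -> (forall k, (k < m)%N -> injective (h k)) ->
    (forall k j, (k < m)%N -> g (h k j) = k) ->
    (forall i, (g i < m)%N /\ exists j, h (g i) j = i) ->
  theta e w = \sum_(k < m) theta (e \o h k) (w \o h k).
Proof.
move=> fe hI gh hg; apply/fpsP => n.
have -> : (\sum_(k < m) theta (e \o h k) (w \o h k)).[q^n] =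
    \sum_(k < m) (theta (e \o h k) (w \o h k)).[q^n].
  by apply: (big_morph (fun s : fps int => s.[q^n])) => [s t|]; rewrite ?fcoefD ?fcoef0.
rewrite /= (@fsbig_fibre _ _ _ m g) //; last by move=> i _; case: (hg i).
apply: eq_bigr => k _; apply: reindex_fsbig; split.
- by move=> j /= ehj; split=> //=; rewrite gh.
- by move=> i j _ _; apply: hI.
- by move=> i [/= ei gi]; have [_ [j hj]] := hg i; exists j; rewrite -gi //= hj.
Qed.

(** * Theta series of one-variable quadratic exponents *)

Lemma finite_int_ball (B : nat) : finite_set [set n : int | `|n| <= B%:Z].
Proof.
apply: (@sub_finite_set _ _ ((fun i : nat => i%:Z - B%:Z) @` `I_(B.*2.+1))).
  by move=> n /= nB; exists (absz (n + B%:Z)) => /=; lia.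
exact/finite_image/finite_II.
Qed.

(** For a nonzero integer n, |A n| >= |B|, so n and A n + B never have opposite signs. *)
Lemma quad_ge0 (A B n : int) : `|B| <= A -> 0 <= A * n ^+ 2 + B * n.
Proof.
move=> BA; have -> : A * n ^+ 2 + B * n = n * (A * n + B) by ring.
have [n0|n0] := leP 0 n; last by rewrite nmulr_rge0 //; nia.
have [->|n1] := eqVneq n 0; first by rewrite mul0r.
by rewrite mulr_ge0 //; nia.
Qed.

Lemma quad_locally_finite (A B : int) : 0 < A -> `|B| <= A ->
  locally_finite (fun n : int => A * n ^+ 2 + B * n).
Proof.
move=> A0 BA N; apply: sub_finite_set (finite_int_ball N.+1) => n /= eN.
have {}eN : n * (A * n + B) = N by rewrite -eN; ring.
(* For |n| > 1, |A n + B| >= |n| - 1 with the sign of n, so |n| (|n| - 1) <= N. *)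
have [n1|] := leP `|n| 1; first by lia.
have [n0 n2|n0 n2] := leP 0 n.
  have : n - 1 <= A * n + B by nia.
  nia.
have : A * n + B <= n + 1 by nia.
nia.
Qed.

Definition qtheta (A B : int) (w : int -> int) : fps int :=
  theta (fun n => A * n ^+ 2 + B * n) w.

Definition altz (n : int) : int := (-1) ^ n.

(** In this form sign identities between weights are linear in parities and fall to [lia]. *)
Lemma altzE n : altz n = 1 - 2 * (n %% 2)%Z.
Proof.
rewrite /altz {1}(divz_eq n 2) exprzDr ?unitrN1 // [(n %/ 2)%Z * 2]mulrC -exprz_exp.
have -> : ((-1) ^ 2 : int) = 1 by [].
by rewrite exp1rz mul1r; have [->|->] : (n %% 2)%Z = 0 \/ (n %% 2)%Z = 1 by lia.
Qed.

Lemma altzM m n : altz m * altz n = altz (m + n).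
Proof. by rewrite /altz exprzDr ?unitrN1. Qed.

Lemma eq_qtheta A B w w' : w =1 w' -> qtheta A B w = qtheta A B w'.
Proof. exact: eq_theta. Qed.

Lemma qtheta_subst (d : nat) A B w : (0 < d)%N ->
  qtheta (d%:Z * A) (d%:Z * B) w = (qtheta A B w)∘q^d.
Proof.
by move=> d0; rewrite -theta_subst //; apply: eq_theta => // n; ring.
Qed.

Lemma qtheta_opp A B w : qtheta A (- B) w = qtheta A B (w \o -%R).
Proof.
rewrite /qtheta (@theta_reindex _ _ (-%R : int -> int)); last first.
  by exists -%R; exact: opprK.
by apply: eq_theta => // n /=; ring.
Qed.

(** The series equals its own opposite, and the integers have no 2-torsion. *)
Lemma theta_odd (I : choiceType) (h : I -> I) (e w : I -> int) :
  bijective h -> e \o h =1 e -> (forall i, w (h i) = - w i) -> theta e w = 0.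
Proof.
move=> hb eh wh; apply/fpsP => n; rewrite fcoef0.
have /fpsP/(_ n) : theta e w = - theta e w.
  by rewrite {1}(theta_reindex _ _ hb) -thetaN; apply: eq_theta.
rewrite fcoefN; lia.
Qed.

(** Substitute m n + c k for n, with [c] a complete residue system modulo m. The bounds on 2 A c k +
    B keep every component in the range where [quad_ge0] applies, which forces balanced
    representatives. *)
Lemma qtheta_dissect (m : nat) (c : nat -> int) (A B : int) (w : int -> int) :
    (0 < m)%N -> 0 < A -> `|B| <= A ->
    (forall k, (k < m)%N -> (c k %% m)%Z = k) ->
    (forall k, (k < m)%N -> - (m%:Z * A) <= 2 * A * c k + B /\ 2 * A * c k + B <= m%:Z * A) ->
  qtheta A B w = \sum_(0 <= k < m) 'q ^+ absz (A * c k ^+ 2 + B * c k) *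
    (qtheta (m%:Z * A) (2 * A * c k + B) (fun n => w (m%:Z * n + c k)))∘q^m.
Proof.
move=> m0 A0 BA cE cA; rewrite big_mkord.
rewrite /qtheta (@theta_split _ _ m (fun k (n : int) => m%:Z * n + c k)
  (fun n : int => `|n %% m|%Z%N)) //.
- apply: eq_bigr => k _; rewrite -theta_subst // -theta_shift.
    apply: eq_theta => n //=.
    rewrite gez0_abs ?quad_ge0 //; ring.
  by move=> n; rewrite mulr_ge0 // quad_ge0 // ler_norml; apply/andP/cA.
- exact: quad_locally_finite.
- by move=> k _ i j; nia.
- by move=> k j km; rewrite mulrC modzMDl cE.
- move=> n; have nm : (`|n %% m|%Z < m)%N by have := ltz_pmod n (_ : 0 < m%:Z); lia.
  split=> //; exists ((n - c `|n %% m|%Z%N) %/ m)%Z.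
  apply/eqP; rewrite mulrC divzK ?subrK //.
  rewrite -eqz_mod_dvd; apply/eqP; rewrite cE //; lia.
Qed.

Lemma phi_negE : phi_neg = qtheta 1 0 altz.
Proof.
apply/fpsP => n; rewrite /phi_neg /qtheta /theta /=.
rewrite (bigfs _ (r := index_enum _)) ?index_enum_uniq //; last first.
  by move=> i _; rewrite mem_index_enum.
rewrite (reindex_fsbig (fun i : 'I_(n.*2.+1) => i%:Z - n%:Z)
  [set` (fun i : 'I_(n.*2.+1) => (i%:Z - n%:Z) ^+ 2 == n%:Z)]) //.
split.
- by move=> i /= /eqP in_n; rewrite mul1r mul0r addr0.
- by move=> i j _ _ ij; apply/val_inj => /=; move: ij; lia.
(* From j^2 = n follows |j| <= n, so j + n is a legal index. *)
- move=> j /=; rewrite mul1r mul0r addr0 => jn; have jn2 : (absz (j + n%:Z)%R < n.*2.+1)%N by nia.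
  have jE : Posz (absz (j + n%:Z)) - n%:Z = j by nia.
  exists (Ordinal jn2); last exact: jE.
  by apply/eqP; rewrite -[RHS]jn; congr (_ ^+ 2); exact: jE.
Qed.

(** * Products of two theta series as lattice sums *)

Lemma qthetaM (A B A' B' : int) (w w' : int -> int) :
    0 < A -> `|B| <= A -> 0 < A' -> `|B'| <= A' ->
  qtheta A B w * qtheta A' B' w' =
    theta (fun p : int * int => (A * p.1 ^+ 2 + B * p.1) + (A' * p.2 ^+ 2 + B' * p.2))
          (fun p => w p.1 * w' p.2).
Proof.
by move=> *; apply: thetaM; [apply: quad_locally_finite..| |] => // n; apply: quad_ge0.
Qed.

Lemma quad2_locally_finite (A B A' B' : int) :
    0 < A -> `|B| <= A -> 0 < A' -> `|B'| <= A' ->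
  locally_finite (fun p : int * int =>
    (A * p.1 ^+ 2 + B * p.1) + (A' * p.2 ^+ 2 + B' * p.2)).
Proof.
move=> A0 BA A'0 B'A'; apply: (@locally_finiteD _ _ (fun n => A * n ^+ 2 + B * n)
  (fun n => A' * n ^+ 2 + B' * n)).
- exact: quad_locally_finite.
- exact: quad_locally_finite.
- by move=> n; apply: quad_ge0.
- by move=> n; apply: quad_ge0.
Qed.

(* The lattice Z^2 is the disjoint union of the images of
   (x, y) |-> (x + y, x - y) and (x, y) |-> (x + y - 1, x - y). *)
Lemma qthetaM_rotate (A B B' : int) (w w' : int -> int) :
    0 < A -> `|B| <= A -> `|B'| <= A ->
  qtheta A B w * qtheta A B' w' =
    theta (fun p : int * int => ((2 * A) * p.1 ^+ 2 + (B + B') * p.1) +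
                                ((2 * A) * p.2 ^+ 2 + (B - B') * p.2))
          (fun p => w (p.1 + p.2) * w' (p.1 - p.2)) +
    theta (fun p : int * int => ((2 * A) * p.1 ^+ 2 + (B + B' - 2 * A) * p.1) +
                                ((2 * A) * p.2 ^+ 2 + (B - B' - 2 * A) * p.2) + (A - B))
          (fun p => w (p.1 + p.2 - 1) * w' (p.1 - p.2)).
Proof.
move=> A0 BA B'A; rewrite qthetaM //.
pose h (k : nat) (p : int * int) := (p.1 + p.2 - k%:Z, p.1 - p.2).
rewrite (@theta_split _ _ 2 h (fun p => absz ((p.1 + p.2) %% 2)%Z)).
- rewrite big_ord_recl big_ord1; congr (_ + _).
    by apply: eq_theta => -[x y] /=; rewrite ?subr0 //; ring.
  by apply: eq_theta => -[x y] //=; rewrite /bump /=; ring.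
- exact: quad2_locally_finite.
- by move=> k _ [x y] [x' y'] [] /=; rewrite /h /= => *; congr (_, _); lia.
- by move=> k [x y]; rewrite /h /=; lia.
- move=> [x y]; split; rewrite /=; first by lia.
  exists (divz (x + y + modz (x + y) 2) 2, divz (x - y + modz (x + y) 2) 2).
  by rewrite /h /=; congr (_, _); lia.
Qed.

(* Z[i] is the disjoint union of 5 translates of (2 - i) Z[i]. *)
Lemma qthetaM_gauss (w w' : int -> int) :
  qtheta 1 0 w * qtheta 1 0 w' =
    \sum_(k < 5) theta (fun p : int * int =>
        (5 * p.1 ^+ 2 + 2 * nth 0 [:: 0; 1; 2; -2; -1] k * p.1) +
        (5 * p.2 ^+ 2 + 2 * nth 0 [:: 0; -2; 1; -1; 2] k * p.2) +
        nth 0 [:: 0; 1; 1; 1; 1] k)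
      (fun p => w (2 * p.1 + p.2 + nth 0 [:: 0; 0; 1; -1; 0] k) *
                w' (2 * p.2 - p.1 + nth 0 [:: 0; -1; 0; 0; 1] k)).
Proof.
rewrite qthetaM //.
pose h (k : nat) (p : int * int) :=
  (2 * p.1 + p.2 + nth 0 [:: 0; 0; 1; -1; 0] k, 2 * p.2 - p.1 + nth 0 [:: 0; -1; 0; 0; 1] k).
rewrite (@theta_split _ _ 5 h (fun p => absz ((2 * p.1 - p.2) %% 5)%Z)).
- apply: eq_bigr => -[k kP] _; apply: eq_theta => -[x y] //=.
  by move: k kP => [|[|[|[|[|k]]]]] //= _; ring.
- exact: quad2_locally_finite.
- by move=> k _ [x y] [x' y'] [] /=; rewrite /h /= => *; congr (_, _); lia.
- by move=> [|[|[|[|[|k]]]]] [x y] // _; rewrite /h /=; lia.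
- move=> [x y]; rewrite /=; split; first by lia.
  have : ((2 * x - y) %% 5)%Z = 0 \/ ((2 * x - y) %% 5)%Z = 1 \/ ((2 * x - y) %% 5)%Z = 2
     \/ ((2 * x - y) %% 5)%Z = 3 \/ ((2 * x - y) %% 5)%Z = 4 by lia.
  move=> [|[|[|[|]]]] r; rewrite r; move: r => r.
  + exists (((2 * x - y) %/ 5)%Z, ((x + 2 * y) %/ 5)%Z).
    by rewrite /h /=; congr (_, _); lia.
  + exists (((2 * x - y - 1) %/ 5)%Z, ((x + 2 * y + 2) %/ 5)%Z).
    by rewrite /h /=; congr (_, _); lia.
  + exists (((2 * x - y - 2) %/ 5)%Z, ((x + 2 * y - 1) %/ 5)%Z).
    by rewrite /h /=; congr (_, _); lia.
  + exists (((2 * x - y + 2) %/ 5)%Z, ((x + 2 * y + 1) %/ 5)%Z).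
    by rewrite /h /=; congr (_, _); lia.
  exists (((2 * x - y + 1) %/ 5)%Z, ((x + 2 * y - 2) %/ 5)%Z).
  by rewrite /h /=; congr (_, _); lia.
Qed.

(** * The series phi(q) and psi(q), and dissections modulo 2 and 5 *)

Definition one_wt : int -> int := fun=> 1.
Definition phi_pos : fps int := qtheta 1 0 one_wt.
(** Ramanujan's psi(q): the numbers 2n^2 + n, for n in Z, are the triangular numbers, each taken
    once. *)
Definition psi : fps int := qtheta 2 1 one_wt.
(** Jacobi's series for f_1^3: pairing each integer with a triangular number turns sum (-1)^m (2m+1)
    q^(m(m+1)/2) into this form. *)
Definition jac : fps int := qtheta 2 1 (fun n => 4 * n + 1).

Lemma qtheta_even A B : qtheta A (- B) one_wt = qtheta A B one_wt.
Proof. exact: qtheta_opp. Qed.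

(** The odd class is represented by -1: for B > 0, the choice 1 would give the linear coefficient 2
    A + B, which is out of range. *)
Lemma qtheta_dissect2 (A B : int) (k : nat) (w : int -> int) :
    0 < A -> 0 <= B <= A -> k%:Z = A - B ->
  qtheta A B w = (qtheta (2 * A) B (fun n => w (2 * n)))∘q^2 +
    'q ^+ k * (qtheta (2 * A) (B - 2 * A) (fun n => w (2 * n - 1)))∘q^2.
Proof.
move=> A0 BA kE; have B0 : `|B| <= A by lia.
rewrite (@qtheta_dissect 2 (nth 0 [:: 0; -1])) //; first last.
- by move=> [|[|]] // _; rewrite [nth _ _ _]/=; lia.
- by move=> [|[|]].
rewrite big_nat_recl // big_nat1; congr (_ + _); rewrite [nth _ _ _]/=.
  rewrite expr0n !mulr0 !addr0 expr0 mul1r; congr fps_subst.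
  by apply: eq_theta => n; rewrite ?add0r ?addr0.
have -> : absz (A * (-1) ^+ 2 + B * -1) = k by rewrite expr2; lia.
by congr (_ * fps_subst _ _); apply: eq_theta => n; rewrite ?mulrN1 // [- _ + B]addrC.
Qed.

(** The [k1], ..., [k4] are the values A c^2 + B c at c = 1, 2, -2, -1. *)
Lemma qtheta_dissect5 (A B : int) (k1 k2 k3 k4 : nat) (w : int -> int) :
    0 < A -> `|B| <= A ->
    k1%:Z = A + B -> k2%:Z = 4 * A + 2 * B -> k3%:Z = 4 * A - 2 * B -> k4%:Z = A - B ->
  qtheta A B w = (qtheta (5 * A) B (fun n => w (5 * n + 0)))∘q^5 +
    'q ^+ k1 * (qtheta (5 * A) (2 * A + B) (fun n => w (5 * n + 1)))∘q^5 +
    'q ^+ k2 * (qtheta (5 * A) (4 * A + B) (fun n => w (5 * n + 2)))∘q^5 +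
    'q ^+ k3 * (qtheta (5 * A) (B - 4 * A) (fun n => w (5 * n - 2)))∘q^5 +
    'q ^+ k4 * (qtheta (5 * A) (B - 2 * A) (fun n => w (5 * n - 1)))∘q^5.
Proof.
move=> A0 BA k1E k2E k3E k4E.
rewrite (@qtheta_dissect 5 (nth 0 [:: 0; 1; 2; -2; -1])) //; first last.
- by move=> [|[|[|[|[|]]]]] // _; rewrite [nth _ _ _]/=; lia.
- by move=> [|[|[|[|[|]]]]].
do 5 rewrite big_nat_recl //; rewrite big_geq // addr0 !addrA.
rewrite ![nth _ _ _]/= (_ : absz (A * 0 ^+ 2 + B * 0) = 0%N); last by rewrite expr2; lia.
rewrite (_ : absz (A * 1 ^+ 2 + B * 1) = k1); last by rewrite expr2; lia.
rewrite (_ : absz (A * 2 ^+ 2 + B * 2) = k2); last by rewrite expr2; lia.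
rewrite (_ : absz (A * (-2) ^+ 2 + B * -2) = k3); last by rewrite expr2; lia.
rewrite (_ : absz (A * (-1) ^+ 2 + B * -1) = k4); last by rewrite expr2; lia.
rewrite (_ : 2 * A * 0 + B = B); last by lia.
rewrite (_ : 2 * A * 1 + B = 2 * A + B); last by lia.
rewrite (_ : 2 * A * 2 + B = 4 * A + B); last by lia.
rewrite (_ : 2 * A * -2 + B = B - 4 * A); last by lia.
rewrite (_ : 2 * A * -1 + B = B - 2 * A); last by lia.
by rewrite expr0 mul1r.
Qed.

(** The classes 1, -1 and likewise 2, -2 contribute equally, by n -> -n. *)
Lemma phi_neg_dissect : phi_neg = (qtheta 5 0 altz)∘q^5
  - 2 * 'q * (qtheta 5 2 altz)∘q^5 + 2 * 'q ^+ 4 * (qtheta 5 4 altz)∘q^5.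
Proof.
rewrite phi_negE (@qtheta_dissect5 1 0 1 4 4 1) //.
have -> : qtheta (5 * 1) 0 (fun n => altz (5 * n + 0)) = qtheta 5 0 altz.
  by apply: eq_qtheta => n; rewrite !altzE; lia.
have -> : qtheta (5 * 1) (2 * 1 + 0) (fun n => altz (5 * n + 1)) = - qtheta 5 2 altz.
  by rewrite -thetaN; apply: eq_theta => // n; rewrite !altzE; lia.
have -> : qtheta (5 * 1) (4 * 1 + 0) (fun n => altz (5 * n + 2)) = qtheta 5 4 altz.
  by apply: eq_qtheta => n; rewrite !altzE; lia.
have -> : qtheta (5 * 1) (0 - 4 * 1) (fun n => altz (5 * n - 2)) = qtheta 5 4 altz.
  rewrite (_ : 0 - 4 * 1 = - 4) // qtheta_opp.
  by apply: eq_qtheta => n; rewrite /= !altzE; lia.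
have -> : qtheta (5 * 1) (0 - 2 * 1) (fun n => altz (5 * n - 1)) = - qtheta 5 2 altz.
  rewrite (_ : 0 - 2 * 1 = - 2) // qtheta_opp -thetaN.
  by apply: eq_theta => // n; rewrite /= !altzE; lia.
rewrite substN; ring.
Qed.

(** Multiplication by 2 - i scales the norm form by 5. The trivial coset gives a^2; each of the
    other four has least norm 1 and gives the same product - q b c. *)
Lemma phi_neg_sqr :
  phi_neg ^+ 2 = qtheta 5 0 altz ^+ 2 - 4 * 'q * qtheta 5 2 altz * qtheta 5 4 altz.
Proof.
rewrite phi_negE [LHS]expr2 qthetaM_gauss !big_ord_recl big_ord0 /bump /=.
(* On each coset the weight is (-1)^(x + y) times the constant sign [s] = (-1)^(c + c'). *)
have term (B B' c c' : int) (k : nat) (s : int) :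
    `|2 * B| <= 5 -> `|2 * B'| <= 5 -> ((c + c') %% 2)%Z = ((1 - s) %/ 2)%Z ->
    `|s| = 1 ->
    theta (fun p : int * int => (5 * p.1 ^+ 2 + 2 * B * p.1) +
        (5 * p.2 ^+ 2 + 2 * B' * p.2) + k%:Z)
      (fun p => altz (2 * p.1 + p.2 + c) * altz (2 * p.2 - p.1 + c')) =
    s%:~R * ('q ^+ k * (qtheta 5 (2 * B) altz * qtheta 5 (2 * B') altz)).
  move=> BP B'P cc s1; rewrite qthetaM // -theta_shift.
    rewrite -thetaMl; apply: eq_theta => // p /=.
    by rewrite !altzM !altzE; lia.
  by move=> p; rewrite addr_ge0 // quad_ge0.
have alt_opp B : qtheta 5 (- B) altz = qtheta 5 B altz.
  by rewrite qtheta_opp; apply: eq_qtheta => n; rewrite /= !altzE; lia.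
rewrite (term 0 0 0 0 0 1) // (term 1 (-2) 0 (-1) 1 (-1)) // (term 2 1 1 0 1 (-1)) //.
rewrite (term (-2) (-1) (-1) 0 1 (-1)) // (term (-1) 2 0 1 1 (-1)) //.
rewrite !mulrN !alt_opp (_ : 2 * 0 = 0) // (_ : 2 * 1 = 2) // (_ : 2 * 2 = 4) //.
ring.
Qed.

(** Since (x + y) + (x - y) is even, the rotation makes the sign constant on each coset: 1 on the
    first and -1 on the second. *)
Lemma altz_qthetaM (i j : int) (k : nat) : 0 <= j <= i -> i <= 4 -> k%:Z = 5 - i ->
  qtheta 5 i altz * qtheta 5 j altz =
    qtheta 10 (i + j) one_wt * qtheta 10 (i - j) one_wt -
    'q ^+ k * (qtheta 10 (10 - i - j) one_wt * qtheta 10 (10 - i + j) one_wt).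
Proof.
move=> ji i4 kE.
rewrite qthetaM_rotate; [|by lia..].
rewrite !qthetaM -?theta_shift -?thetaN; try lia; last first.
  by move=> p; rewrite addr_ge0 ?quad_ge0 //; lia.
congr (_ + _).
  by apply: eq_theta => // p; rewrite altzM altzE /one_wt; lia.
rewrite (@theta_reindex _ _ (fun p : int * int => (- p.1, - p.2))).
  apply: eq_theta => -[x y]; rewrite /= ?kE; first by ring.
  by rewrite altzM altzE /one_wt; lia.
by exists (fun p : int * int => (- p.1, - p.2)) => -[x y]; rewrite /= !opprK.
Qed.

(** * Algebraic relations among the series sum (-1)^n q^(5n^2+Bn) *)

Lemma fps_unit_int s : s.[q^0] = 1 -> s \is a GRing.unit.
Proof. by move=> s0; rewrite [_ \is a _]/(s.[q^0] \is a GRing.unit) s0. Qed.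

Lemma altz_qtheta_unit B : `|B| < 5 -> qtheta 5 B altz \is a GRing.unit.
Proof.
move=> B5; apply: fps_unit_int; rewrite /qtheta /=.
have -> : [set n : int | 5 * n ^+ 2 + B * n = 0] = [set 0].
  apply/seteqP; split=> n /=; last by move=> ->; rewrite expr0n !mulr0.
  have -> : 5 * n ^+ 2 + B * n = n * (5 * n + B) by ring.
  by move=> /eqP; rewrite mulf_eq0 => /orP[/eqP //|/eqP]; lia.
by rewrite fsbig_set1.
Qed.

Section QuinticThetas.
Let a := qtheta 5 0 altz.
Let d := qtheta 5 1 altz.
Let b := qtheta 5 2 altz.
Let e := qtheta 5 3 altz.
Let c := qtheta 5 4 altz.

Let a_unit : a \is a GRing.unit. Proof. exact: altz_qtheta_unit. Qed.
Let b_unit : b \is a GRing.unit. Proof. exact: altz_qtheta_unit. Qed.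
Let c_unit : c \is a GRing.unit. Proof. exact: altz_qtheta_unit. Qed.
Let d_unit : d \is a GRing.unit. Proof. exact: altz_qtheta_unit. Qed.
Let e_unit : e \is a GRing.unit. Proof. exact: altz_qtheta_unit. Qed.

(* Two instances of the three-term relation for theta functions. *)
Lemma altz_qtheta_relations :
  a * c * d ^+ 2 = e * b * (b * d - 'q * c * e) /\
  a * b * e ^+ 2 = c * d * (b * d + 'q * c * e).
Proof.
(* Each product of two thetas is bilinear in the [A k], and both relations become polynomial
   identities in these. *)
pose A (k : int) := qtheta 10 k one_wt.
have ca : c * a = A 4 * A 4 - 'q * (A 6 * A 6) by apply: (altz_qthetaM (k := 1)).
have dd : d * d = A 2 * A 0 - 'q ^+ 4 * (A 8 * A 10) by apply: altz_qthetaM.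
have bb : b * b = A 4 * A 0 - 'q ^+ 3 * (A 6 * A 10) by apply: altz_qthetaM.
have ed : e * d = A 4 * A 2 - 'q ^+ 2 * (A 6 * A 8) by apply: altz_qthetaM.
have ee : e * e = A 6 * A 0 - 'q ^+ 2 * (A 4 * A 10) by apply: altz_qthetaM.
have cb : c * b = A 6 * A 2 - 'q * (A 4 * A 8) by apply: (altz_qthetaM (k := 1)).
have ba : b * a = A 2 * A 2 - 'q ^+ 3 * (A 8 * A 8) by apply: altz_qthetaM.
have cc : c * c = A 8 * A 0 - 'q * (A 2 * A 10) by apply: (altz_qthetaM (k := 1)).
split.
  transitivity ((b * b) * (e * d) - 'q * ((e * e) * (c * b))); last by ring.
  transitivity ((c * a) * (d * d)); first by ring.
  by rewrite ca dd bb ed ee cb; ring.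
transitivity ((c * b) * (d * d) + 'q * ((c * c) * (e * d))); last by ring.
transitivity ((b * a) * (e * e)); first by ring.
by rewrite ba ee cb dd cc ed; ring.
Qed.

(** Eliminating [d] and [e] from the two relations leaves one between the three series of the
    5-dissection of phi(-q). *)
Lemma altz_qtheta_quintic :
  a * (b ^+ 5 - 'q ^+ 3 * c ^+ 5) =
    a ^+ 4 * b * c + 'q * a ^+ 2 * b ^+ 2 * c ^+ 2 + 2 * 'q ^+ 2 * b ^+ 3 * c ^+ 3.
Proof.
have [h1 h2] := altz_qtheta_relations.
(* [h1] and [h2] are two quadratic equations for e / d; their resultant is M^2 + L N. *)
pose L := b * ('q ^+ 2 * c ^+ 3 - a * b ^+ 2).
pose M := b * c * (a ^+ 2 + 'q * b * c).
pose N := c * (b ^+ 3 + 'q * a * c ^+ 2).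
have Le : L * e = - (M * d).
  apply: (mulrI d_unit).
  transitivity (d * - (M * d) - a * b * (e * b * (b * d - 'q * c * e))
    + a * b * (a * c * d ^+ 2) + 'q * c * b * (c * d * (b * d + 'q * c * e))
    - 'q * c * b * (a * b * e ^+ 2)); last first.
    by rewrite h1 h2; ring.
  rewrite /L /M; ring.
have Me : M * e = N * d.
  apply: (mulrI e_unit).
  transitivity (e * (N * d) - (c * b) * (e * b * (b * d - 'q * c * e)) + c * b * (a * c * d ^+ 2)
    - a * c * (c * d * (b * d + 'q * c * e)) + a * c * (a * b * e ^+ 2)); last first.
    by rewrite h1 h2; ring.
  rewrite /N /M; ring.
have LN : L * N = - (M * M).
  apply: (mulIr d_unit); transitivity (L * (N * d)); first by ring.
  rewrite -Me; transitivity (M * (L * e)); first by ring.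
  by rewrite Le; ring.
(* M^2 + L N is, up to sign, b c times the difference of the two sides. *)
apply: (mulrI b_unit); apply: (mulrI c_unit); apply/eqP; rewrite -subr_eq0; apply/eqP.
transitivity (- (M * M + L * N)); last by rewrite LN; ring.
by rewrite /M /L /N; ring.
Qed.

End QuinticThetas.

(** * The operator U and its recurrence *)

Lemma sect_q d r k : (r < d)%N -> (k < d)%N -> sect d r ('q ^+ k) = (k == r)%:R.
Proof.
move=> rd kd; apply/fpsP => n; rewrite sectE -['q ^+ k]mulr1 fcoefMq fcoef1.
case: n => [|n]; rewrite ?muln0 ?add0n.
  case: ltngtP => kr; rewrite ?fcoef0 ?kr ?subnn //.
  by rewrite (_ : (r - k == 0)%N = false) //; lia.
have -> : (k <= d * n.+1 + r)%N by nia.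
rewrite (_ : (d * n.+1 + r - k == 0)%N = false); last by nia.
by case: eqP => _; rewrite ?fcoef0 ?fcoef1.
Qed.

(** A dissection is unique, so sections can be read off from any exhibited one. *)
Lemma sect_dissect d r (s : nat -> fps int) : (r < d)%N ->
  sect d r (\sum_(0 <= k < d) 'q ^+ k * (s k)∘q^d) = s r.
Proof.
move=> rd; rewrite big_mkord.
have -> : sect d r (\sum_(k < d) 'q ^+ k * (s k)∘q^d) =
    \sum_(k < d) sect d r ('q ^+ k * (s k)∘q^d).
  by apply: (big_morph (sect d r)) => [t u|]; [exact: sectD | exact/fpsP].
rewrite (bigD1 (Ordinal rd)) //= sectM_subst // sect_q // eqxx mul1r.
rewrite big1 ?addr0 // => k kr; rewrite sectM_subst // sect_q //.
by rewrite (_ : (k == r :> nat) = false) ?mul0r //; apply: negbTE.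
Qed.

Lemma sect_dissect5 r (s : nat -> fps int) : (r < 5)%N ->
  sect 5 r ((s 0)∘q^5 + 'q * (s 1)∘q^5 + 'q ^+ 2 * (s 2)∘q^5 +
    'q ^+ 3 * (s 3)∘q^5 + 'q ^+ 4 * (s 4)∘q^5) = s r.
Proof.
move=> r5; rewrite -[RHS](sect_dissect s r5).
by rewrite !big_nat_recr //= big_geq // add0r expr0 mul1r expr1.
Qed.

Lemma phi_neg5 : phi_neg∘q^5 = qtheta 5 0 altz.
Proof. by rewrite phi_negE -qtheta_subst. Qed.

Section Hecke5.
Let a := qtheta 5 0 altz.
Let b := qtheta 5 2 altz.
Let c := qtheta 5 4 altz.
Let f := phi_neg.
Let A := a∘q^5.
Let X := b∘q^5.
Let Y := c∘q^5.

Let f_dissect : f = A - 2 * 'q * X + 2 * 'q ^+ 4 * Y.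
Proof. exact: phi_neg_dissect. Qed.

Let f_sqr : f ^+ 2 = a ^+ 2 - 4 * 'q * b * c.
Proof. exact: phi_neg_sqr. Qed.

(** The second factor is the norm of A - 2 q X + 2 q^4 Y over the fifth roots of unity, with q^5
    replaced by q. *)
Let f_sextic : f ^+ 6 = a * (a ^+ 5 - 32 * 'q * b ^+ 5 + 32 * 'q ^+ 4 * c ^+ 5 +
  20 * 'q * a ^+ 3 * b * c + 80 * 'q ^+ 2 * a * b ^+ 2 * c ^+ 2).
Proof.
transitivity ((f ^+ 2) ^+ 3); first by ring.
rewrite f_sqr; apply/eqP; rewrite -subr_eq0; apply/eqP.
transitivity (32 * 'q * (a * (b ^+ 5 - 'q ^+ 3 * c ^+ 5) - (a ^+ 4 * b * c +
  'q * a ^+ 2 * b ^+ 2 * c ^+ 2 + 2 * 'q ^+ 2 * b ^+ 3 * c ^+ 3))); first by ring.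
by rewrite altz_qtheta_quintic subrr mulr0.
Qed.

Let fe5 : f∘q^5 = a. Proof. exact: phi_neg5. Qed.

(* Qs is the product of the conjugates of f under q |-> zeta q over the four
   nontrivial fifth roots of unity, sorted by exponents modulo 5. *)
Let Q : nat -> fps int := nth 0 [::
  a ^+ 4 + 12 * 'q * a ^+ 2 * b * c + 16 * 'q ^+ 2 * b ^+ 2 * c ^+ 2;
  2 * a ^+ 3 * b + 16 * 'q * a * b ^+ 2 * c + 16 * 'q ^+ 3 * c ^+ 4;
  4 * a ^+ 2 * b ^+ 2 - 8 * 'q ^+ 2 * a * c ^+ 3 + 16 * 'q * b ^+ 3 * c;
  4 * 'q * a ^+ 2 * c ^+ 2 + 8 * a * b ^+ 3 + 16 * 'q ^+ 2 * b * c ^+ 3;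
  - (2 * a ^+ 3 * c) - 16 * 'q * a * b * c ^+ 2 + 16 * b ^+ 4].

Let Qs := (Q 0)∘q^5 + 'q * (Q 1)∘q^5 + 'q ^+ 2 * (Q 2)∘q^5 +
  'q ^+ 3 * (Q 3)∘q^5 + 'q ^+ 4 * (Q 4)∘q^5.

(** Under q -> q^5, [f_sextic] equates a^6 with A times the norm f Qs. *)
Let fQs : f * Qs * A = a ^+ 6.
Proof.
have -> : a ^+ 6 = (f ^+ 6)∘q^5 by rewrite substX // fe5.
rewrite f_sextic f_dissect /Qs /Q /=.
rewrite !(subst_nat, substX, subst_q, substM, substD, substN) // -/A -/X -/Y.
ring.
Qed.

Let G := a5bar_gen.

Let Gf : G * f = a ^+ 5.
Proof. by rewrite a5bar_genE fe5. Qed.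

Let a_unit : a \is a GRing.unit. Proof. exact: altz_qtheta_unit. Qed.
Let f_unit : f \is a GRing.unit. Proof. exact: phi_neg_unit. Qed.

(** Combines G f = a^5 with f Qs A = a^6. Both multipliers here are series in q^5, so they pass
    through [sect 5 0]. *)
Let Ga : G * f∘q^5 = Qs * a∘q^5.
Proof.
rewrite fe5; apply: (mulrI (unitrX 5 a_unit)).
transitivity (G * a ^+ 6); first by ring.
by rewrite -fQs -Gf -/A; ring.
Qed.

Let UG : sect 5 0 G = 5 * G - 5 * a ^+ 3 * f + a * f ^+ 3.
Proof.
apply: (mulIr f_unit); rewrite -sectM_subst // Ga sectM_subst // sect_dissect5 //.
(* By [f_sqr], 4 q b c = a^2 - f^2, which turns [Q 0] into 5 a^4 - 5 a^2 f^2 + f^4. *)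
transitivity (5 * (G * f) - 5 * a ^+ 3 * f ^+ 2 + a * (f ^+ 2) ^+ 2); last by ring.
by rewrite Gf f_sqr /Q /=; ring.
Qed.

Let Uf : sect 5 0 f = a.
Proof.
rewrite f_dissect.
pose s := nth 0 [:: a; - (2 * b); 0; 0; 2 * c] : nat -> fps int.
rewrite -[RHS](@sect_dissect5 0 s) //; congr (sect 5 0 _).
rewrite /s /= !(subst_nat, substX, subst_q, substM, substD, substN) // -/A -/X -/Y.
rewrite (subst_nat 0) //; ring.
Qed.

Let Uf3 : sect 5 0 (f ^+ 3) = a ^+ 3 - 24 * 'q * a * b * c.
Proof.
rewrite f_dissect.
(* The cube of A - 2 q X + 2 q^4 Y, sorted by exponents modulo 5. *)
pose s := nth 0 [:: a ^+ 3 - 24 * 'q * a * b * c; - (6 * a ^+ 2 * b) + 24 * 'q * b ^+ 2 * c;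
  12 * a * b ^+ 2 + 8 * 'q ^+ 2 * c ^+ 3; - (8 * b ^+ 3) + 12 * 'q * a * c ^+ 2;
  6 * a ^+ 2 * c - 24 * 'q * b * c ^+ 2] : nat -> fps int.
rewrite -[RHS](@sect_dissect5 0 s) //; congr (sect 5 0 _).
rewrite /s /= !(subst_nat, substX, subst_q, substM, substD, substN) // -/A -/X -/Y.
ring.
Qed.

(** Since a = f∘q^5, powers of a leave U as powers of f: U(a^3 f) = a f^3 and U(a f^3) = f U(f^3).
    By [f_sqr] the latter is 6 a f^3 - 5 a^3 f. *)
Lemma a5bar_gen_hecke5 : sect 5 0 (sect 5 0 G) = 6 * sect 5 0 G - 5 * G.
Proof.
have U s t : sect 5 0 (s * t∘q^5) = sect 5 0 s * t by exact: sectM_subst.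
have U5 s : sect 5 0 (5 * s) = 5 * sect 5 0 s.
  by rewrite mulrC -[in LHS](@subst_nat 5 5) // U mulrC.
rewrite {1}UG !sectD sectN -mulrA !U5.
rewrite [X in - (5 * sect 5 0 X)]mulrC [X in _ + sect 5 0 X]mulrC -fe5 -substX // !U Uf Uf3.
rewrite !UG.
apply/eqP; rewrite -subr_eq0; apply/eqP.
transitivity (6 * f * a * (a ^+ 2 - 4 * 'q * b * c - f ^+ 2)); first by ring.
by rewrite f_sqr subrr mulr0.
Qed.
End Hecke5.

(** * Classical identities for phi and psi, and Jacobi's identity *)

Lemma qtheta_2_2 : qtheta 2 2 one_wt = 2 * psi∘q^4.
Proof.
rewrite (@qtheta_dissect2 2 2 0) // expr0 mul1r.
rewrite (_ : 2 - 2 * 2 = - 2) // -/one_wt qtheta_even (_ : 2 * 2 = 4) //.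
have -> : qtheta 4 2 one_wt = psi∘q^2 by rewrite -qtheta_subst.
by rewrite subst_subst //; ring.
Qed.

Lemma qtheta_2_0 : qtheta 2 0 one_wt = phi_pos∘q^2.
Proof. by rewrite -qtheta_subst. Qed.

Lemma qtheta_4_2 : qtheta 4 2 one_wt = psi∘q^2.
Proof. by rewrite -qtheta_subst. Qed.

Lemma phi_pos_dissect : phi_pos = phi_pos∘q^4 + 2 * 'q * psi∘q^8.
Proof.
rewrite {1}/phi_pos (@qtheta_dissect2 1 0 1) //.
rewrite (_ : 0 - 2 * 1 = - 2) // (_ : 2 * 1 = 2) // -/one_wt qtheta_even qtheta_2_2 qtheta_2_0.
by rewrite substM // subst_nat // !subst_subst //; ring.
Qed.

Lemma phi_neg_dissect2 : phi_neg = phi_pos∘q^4 - 2 * 'q * psi∘q^8.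
Proof.
rewrite phi_negE (@qtheta_dissect2 1 0 1) //.
rewrite (_ : 0 - 2 * 1 = - 2) // (_ : 2 * 1 = 2) //.
have -> : qtheta 2 0 (fun n => altz (2 * n)) = qtheta 2 0 one_wt.
  by apply: eq_qtheta => n; rewrite altzE /one_wt; lia.
have -> : qtheta 2 (- 2) (fun n => altz (2 * n - 1)) = - qtheta 2 2 one_wt.
  by rewrite -qtheta_even -thetaN; apply: eq_theta => // n; rewrite altzE /one_wt; lia.
rewrite qtheta_2_2 qtheta_2_0.
by rewrite substN substM // subst_nat // !subst_subst //; ring.
Qed.

Lemma one_qthetaM_rotate (A B B' : int) (k : nat) :
    0 < A -> 0 <= B' <= B -> B + B' <= 2 * A -> k%:Z = A - B ->
  qtheta A B one_wt * qtheta A B' one_wt =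
    qtheta (2 * A) (B + B') one_wt * qtheta (2 * A) (B - B') one_wt +
    'q ^+ k * (qtheta (2 * A) (2 * A - B - B') one_wt * qtheta (2 * A) (2 * A - B + B') one_wt).
Proof.
move=> A0 BB BA kE; rewrite qthetaM_rotate; try lia.
congr (_ + _); first by rewrite qthetaM; try lia.
rewrite (_ : 2 * A - B - B' = - (B + B' - 2 * A)); last by ring.
rewrite (_ : 2 * A - B + B' = - (B - B' - 2 * A)); last by ring.
rewrite !qtheta_even qthetaM; try lia.
rewrite -theta_shift; last by move=> p; rewrite addr_ge0 ?quad_ge0 //; lia.
by apply: eq_theta => // p; rewrite /= kE.
Qed.

Lemma phi_pos_sqr : phi_pos ^+ 2 = phi_pos∘q^2 ^+ 2 + 4 * 'q * psi∘q^4 ^+ 2.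
Proof.
rewrite [LHS]expr2 {1 2}/phi_pos (@one_qthetaM_rotate _ _ _ 1) //.
rewrite (_ : 2 * 1 = 2) // qtheta_2_0 qtheta_2_2; ring.
Qed.

Lemma qtheta_4_4 : qtheta 4 4 one_wt = 2 * psi∘q^8.
Proof.
have -> : qtheta 4 4 one_wt = (qtheta 2 2 one_wt)∘q^2 by rewrite -qtheta_subst.
by rewrite qtheta_2_2 substM // subst_nat // subst_subst.
Qed.

Lemma qtheta_4_0 : qtheta 4 0 one_wt = phi_pos∘q^4.
Proof. by rewrite -qtheta_subst. Qed.

(** The rotation yields psi(q^2) times the 2-dissection of phi(q). *)
Lemma psi_sqr : psi ^+ 2 = phi_pos * psi∘q^2.
Proof.
rewrite [LHS]expr2 {1 2}/psi (@one_qthetaM_rotate _ _ _ 1) //.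
rewrite (_ : 2 * 2 = 4) // (_ : 4 - 1 - 1 = 2) // (_ : 4 - 1 + 1 = 4) //.
by rewrite qtheta_4_2 qtheta_4_0 qtheta_4_4 [in RHS]phi_pos_dissect; ring.
Qed.

(** Passing from phi(q) to phi(-q) flips the sign of the odd part 2 q psi(q^8), hence of the cross
    term 4 q phi(q^4) psi(q^8) = 4 q psi(q^4)^2. *)
Lemma phi_neg_sqr2 : phi_neg ^+ 2 = phi_pos∘q^2 ^+ 2 - 4 * 'q * psi∘q^4 ^+ 2.
Proof.
have psi4 : psi∘q^4 ^+ 2 = phi_pos∘q^4 * psi∘q^8.
  by have := congr1 (fps_subst 4) psi_sqr; rewrite substX // substM // subst_subst.
have := phi_pos_sqr; have := phi_neg_dissect2; have := phi_pos_dissect.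
rewrite psi4; move: phi_pos∘q^4 psi∘q^8 => X Y posE negE sqr.
transitivity (phi_pos ^+ 2 - 8 * 'q * (X * Y)); first by rewrite negE posE; ring.
by rewrite sqr; ring.
Qed.

Lemma phi_pos_neg : phi_pos * phi_neg = phi_neg∘q^2 ^+ 2.
Proof.
rewrite -substX // phi_neg_sqr2.
rewrite !(subst_nat, substX, subst_q, substM, substD, substN) // !subst_subst //.
have := phi_neg_dissect2; have := phi_pos_dissect.
by move: phi_pos∘q^4 psi∘q^8 => X Y -> ->; ring.
Qed.

(** On the two cosets of the rotation the weight splits as (4x + 1) + 4y and (4x - 1) + (4y - 2).
    The second summands are odd under y -> -y and y -> 1 - y, so they sum to zero. *)
Lemma jac_psi : jac * psi = jac∘q^2 * phi_neg.
Proof.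
rewrite /jac /psi qthetaM_rotate //.
have q40 : qtheta 4 0 (fun n => 4 * n) = 0.
  by apply: (theta_odd (h := -%R)) => [|n|n] /=; [exists -%R; exact: opprK|ring|ring].
have q44 : qtheta 4 (- 4) (fun n => 4 * n - 2) = 0.
  apply: (theta_odd (h := fun n => 1 - n)) => [|n|n] /=; [|ring|ring].
  by exists (fun n => 1 - n) => n; ring.
have jac2 : qtheta 4 2 (fun n => 4 * n + 1) = jac∘q^2 by rewrite -qtheta_subst.
have -> : theta (fun p : int * int => ((2 * 2) * p.1 ^+ 2 + (1 + 1) * p.1) +
     ((2 * 2) * p.2 ^+ 2 + (1 - 1) * p.2)) (fun p => (4 * (p.1 + p.2) + 1) * one_wt (p.1 - p.2)) =
   jac∘q^2 * phi_pos∘q^4.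
  transitivity (qtheta 4 2 (fun n => 4 * n + 1) * qtheta 4 0 one_wt +
                qtheta 4 2 one_wt * qtheta 4 0 (fun n => 4 * n)).
    rewrite !qthetaM // -thetaD; last exact: quad2_locally_finite.
    by apply: eq_theta => p //=; rewrite /one_wt; ring.
  by rewrite q40 jac2 qtheta_4_0 mulr0 addr0.
have -> : theta (fun p : int * int => ((2 * 2) * p.1 ^+ 2 + (1 + 1 - 2 * 2) * p.1) +
     ((2 * 2) * p.2 ^+ 2 + (1 - 1 - 2 * 2) * p.2) + (2 - 1))
     (fun p => (4 * (p.1 + p.2 - 1) + 1) * one_wt (p.1 - p.2)) =
   - (2 * 'q * (jac∘q^2 * psi∘q^8)).
  transitivity ('q ^+ 1 * (qtheta 4 (- 2) (fun n => 4 * n - 1) * qtheta 4 (- 4) one_wt +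
                qtheta 4 (- 2) one_wt * qtheta 4 (- 4) (fun n => 4 * n - 2))).
    rewrite !qthetaM // -thetaD; last exact: quad2_locally_finite.
    rewrite -theta_shift; last by move=> p; rewrite addr_ge0 ?quad_ge0.
    by apply: eq_theta => p //=; rewrite /one_wt; ring.
  rewrite q44 qtheta_even qtheta_4_4.
  have -> : qtheta 4 (- 2) (fun n => 4 * n - 1) = - jac∘q^2.
    by rewrite qtheta_opp -jac2 -thetaN; apply: eq_theta => n //=; ring.
  by ring.
by rewrite phi_neg_dissect2; ring.
Qed.

Lemma qtheta_2_1_coef0 w : (qtheta 2 1 w).[q^0] = w 0.
Proof.
rewrite /qtheta /=.
have -> : [set n : int | 2 * n ^+ 2 + 1 * n = 0] = [set 0].
  apply/seteqP; split=> n /=; last by move=> ->.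
  by rewrite expr2; nia.
by rewrite fsbig_set1.
Qed.

(** By strong induction: with t(0) = 1 the left side isolates s_n, while the right side involves
    only s_i with i <= n/2. *)
Lemma fps_mul_subst2_eq0 s t u :
  t.[q^0] = 1 -> s.[q^0] = 0 -> s * t = s∘q^2 * u -> s = 0.
Proof.
move=> t0 s0 stu; apply/fpsP => n; rewrite fcoef0.
elim/ltn_ind: n => -[//|n] IH.
have /fpsP/(_ n.+1) := stu; rewrite !fcoefM big_ord_recr /= subnn t0 mulr1.
rewrite big1 ?add0r => [->|i _]; last by rewrite IH ?mul0r.
rewrite big1 // => i _; case: ifP => _; last by rewrite mul0r.
case: (posnP i) => [->|i0]; first by rewrite div0n s0 mul0r.
by rewrite IH ?mul0r //; have := ltn_Pdiv (ltnSn 1) i0; have := ltn_ord i; lia.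
Qed.

(* Both sides satisfy [s(q) psi(q) = s(q^2) phi(-q)]. *)
Lemma jacE : jac = phi_neg ^+ 2 * psi.
Proof.
apply/eqP; rewrite -subr_eq0; apply/eqP.
apply: (@fps_mul_subst2_eq0 _ psi phi_neg); first exact: qtheta_2_1_coef0.
  rewrite fcoefD fcoefN qtheta_2_1_coef0 fcoefM big_ord1 qtheta_2_1_coef0.
  by rewrite expr2 fcoefM big_ord1 [phi_neg.[q^0]]/= big_mkcond big_ord1.
rewrite mulrBl jac_psi substD substN mulrBl; congr (_ - _).
transitivity (phi_neg ^+ 2 * psi ^+ 2); first by ring.
by rewrite substM // substX // -phi_pos_neg psi_sqr; ring.
Qed.

(** * The generating series modulo 5 *)

Lemma subst_int d (c : int) : (0 < d)%N -> (c%:~R : fps int)∘q^d = c%:~R.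
Proof.
by case: c => m d0; rewrite ?NegzE ?mulrNz ?substN -!pmulrn subst_nat.
Qed.

Lemma fcoefMn (k : nat) s n : (k%:R * s).[q^n] = k%:R * s.[q^n].
Proof. by rewrite pmulrn fcoefMz pmulrn intz. Qed.

(** Write s = c + q s'. Fermat's congruence handles c, and modulo 5 the rest is q^5 (s'^5 - s'∘q^5),
    where the coefficient index has dropped by 5. *)
Lemma fps_frobenius5 s : exists u, s ^+ 5 = s∘q^5 + 5 * u.
Proof.
suff dvd n : (5 %| (s ^+ 5 - s∘q^5).[q^n])%Z.
  pose v n := (s ^+ 5 - s∘q^5).[q^n].
  exists (Fps (fun n => divz (v n) 5)); apply/fpsP => n.
  rewrite fcoefD fcoefMn -[(Fps _).[q^n]]/(divz (v n) 5) mulrC divzK //.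
  by rewrite /v fcoefD fcoefN addrC subrK.
elim/ltn_ind: n s => n IH s.
pose c := s.[q^0]; pose s' := Fps (fun n => s.[q^n.+1]).
have sE : s = c%:~R + 'q * s'.
  apply/fpsP => m; rewrite fcoefD -['q]expr1 fcoefMq -[c%:~R]mulr1 fcoefMz fcoef1.
  by case: m => [|m]; rewrite /= ?mulr1 ?addr0 ?mulr0 ?add0r ?subn1.
have -> : s ^+ 5 - s∘q^5 = (c ^+ 5 - c)%:~R * 1 + ('q ^+ 5 * (s' ^+ 5 - s'∘q^5) +
    5 * (c%:~R ^+ 4 * ('q * s') + 2 * c%:~R ^+ 3 * ('q * s') ^+ 2 +
     2 * c%:~R ^+ 2 * ('q * s') ^+ 3 + c%:~R * ('q * s') ^+ 4)).
  rewrite {1 2}sE substD subst_int // substM // subst_q // rmorphB rmorphXn /=; ring.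
rewrite !fcoefD fcoefMz fcoefMn fcoefMq; apply: rpredD.
  apply: dvdz_mulr; rewrite -eqz_mod_dvd -modzXm.
  have : (c %% 5 = 0 \/ c %% 5 = 1 \/ c %% 5 = 2 \/ c %% 5 = 3 \/ c %% 5 = 4)%Z by lia.
  by move=> [|[|[|[|]]]] ->.
apply: rpredD; last exact: dvdz_mulr.
by case: leqP => // n5; apply: IH; lia.
Qed.

Lemma sect_dissect4 r (s : nat -> fps int) : (r < 4)%N ->
  sect 4 r ((s 0)∘q^4 + 'q * (s 1)∘q^4 + 'q ^+ 2 * (s 2)∘q^4 + 'q ^+ 3 * (s 3)∘q^4) = s r.
Proof.
move=> r4; rewrite -[RHS](sect_dissect s r4).
by rewrite !big_nat_recr //= big_geq // add0r expr0 mul1r expr1.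
Qed.

Lemma sect_nat d r (k : nat) s : sect d r (k%:R * s) = k%:R * sect d r s.
Proof. by apply/fpsP => n; rewrite sectE !fcoefMn. Qed.

Lemma phi_pos_dissect5 : phi_pos = phi_pos∘q^25 + 2 * 'q * (qtheta 5 2 one_wt)∘q^5 +
  2 * 'q ^+ 4 * (qtheta 5 4 one_wt)∘q^5.
Proof.
rewrite {1}/phi_pos (@qtheta_dissect5 1 0 1 4 4 1) //.
rewrite (_ : 0 - 4 * 1 = - 4) // (_ : 0 - 2 * 1 = - 2) // -/one_wt !qtheta_even.
rewrite (_ : 2 * 1 + 0 = 2) // (_ : 4 * 1 + 0 = 4) // (_ : 5 * 1 = 5) //.
have -> : qtheta 5 0 one_wt = phi_pos∘q^5 by rewrite -qtheta_subst.
rewrite subst_subst //; ring.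
Qed.

(** The classes n = 0, 2 give [p0] and n = -1, -2 give [p1]. The class n = 1 reproduces psi, as its
    exponents are 25 (2n^2 + n) + 3. *)
Lemma psi_dissect5 : exists p0 p1, psi = p0∘q^5 + 'q * p1∘q^5 + 'q ^+ 3 * psi∘q^25.
Proof.
exists (qtheta 10 1 one_wt + 'q ^+ 2 * qtheta 10 9 one_wt).
exists (qtheta 10 (1 - 2 * 2) one_wt + 'q * qtheta 10 (1 - 4 * 2) one_wt).
rewrite {1}/psi (@qtheta_dissect5 2 1 3 10 6 1) // -/one_wt.
rewrite (_ : 5 * 2 = 10) // (_ : 2 * 2 + 1 = 5) // (_ : 4 * 2 + 1 = 9) //.
have -> : qtheta 10 5 one_wt = psi∘q^5 by rewrite -qtheta_subst.
by rewrite !(subst_q, substX, substM, substD) // subst_subst //; ring.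
Qed.

(** On the class n = 1, which carries the exponents 3 modulo 5, the weight 4n + 1 is a multiple of
    5. *)
Lemma jac_dissect5 : exists j0 j1 j3, jac = j0∘q^5 + 'q * j1∘q^5 + 5 * j3.
Proof.
pose w (c n : int) := 4 * (5 * n + c) + 1.
exists (qtheta 10 1 (w 0) + 'q ^+ 2 * qtheta 10 9 (w 2)).
exists (qtheta 10 (1 - 2 * 2) (w (-1)) + 'q * qtheta 10 (1 - 4 * 2) (w (-2))).
exists ('q ^+ 3 * (qtheta 10 5 (fun n => 4 * n + 1))∘q^5).
rewrite {1}/jac (@qtheta_dissect5 2 1 3 10 6 1) //.
rewrite (_ : 5 * 2 = 10) // (_ : 2 * 2 + 1 = 5) // (_ : 4 * 2 + 1 = 9) //.
have -> : qtheta 10 5 (fun n => 4 * (5 * n + 1) + 1) = 5 * qtheta 10 5 (fun n => 4 * n + 1).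
  rewrite [5 in RHS]pmulrn -thetaMl; apply: eq_theta => n //; ring.
by rewrite !(subst_nat, subst_q, substX, substM, substD) //; ring.
Qed.

(** Iterating [phi_pos_neg] gives phi(-q^4)^4 = phi(-q) phi(q) phi(q^2)^2, which clears the
    denominator. One more factor phi(-q^4) completes a fifth power, to which Frobenius applies. *)
Lemma a5bar_gen_mod5 : exists u, a5bar_gen * phi_neg∘q^20 =
  phi_neg∘q^25 * phi_pos * phi_pos∘q^2 ^+ 2 * phi_neg∘q^4 + 5 * u.
Proof.
have [u uE] := fps_frobenius5 phi_neg.
exists (u∘q^5 * phi_pos * phi_pos∘q^2 ^+ 2 * phi_neg∘q^4 - a5bar_gen * u∘q^4).
have G4 : a5bar_gen * phi_neg∘q^4 ^+ 4 = phi_neg∘q^5 ^+ 5 * phi_pos * phi_pos∘q^2 ^+ 2.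
  rewrite -a5bar_genE.
  have -> : phi_neg∘q^4 ^+ 4 = (phi_pos * phi_neg) * phi_pos∘q^2 ^+ 2.
    rewrite phi_pos_neg -exprMn -substM // [phi_neg * _]mulrC phi_pos_neg.
    by rewrite substX // subst_subst //; ring.
  ring.
have u5 := congr1 (fps_subst 5) uE; have u4 := congr1 (fps_subst 4) uE.
rewrite !(subst_nat, substX, substM, substD) // !subst_subst // in u5 u4.
have -> : phi_neg∘q^20 = phi_neg∘q^4 ^+ 5 - 5 * u∘q^4 by rewrite u4; ring.
have -> : phi_neg∘q^25 = phi_neg∘q^5 ^+ 5 - 5 * u∘q^5 by rewrite u5; ring.
transitivity ((a5bar_gen * phi_neg∘q^4 ^+ 4) * phi_neg∘q^4 - 5 * (a5bar_gen * u∘q^4)).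
  by ring.
by rewrite G4; ring.
Qed.

Lemma a5bar_gen_sect4 : exists u, sect 4 2 a5bar_gen * phi_neg∘q^5 =
  4 * (jac∘q^2 * (phi_pos∘q^25 * psi∘q^2 - 'q ^+ 6 * psi∘q^50 * phi_pos)) + 5 * u.
Proof.
have [u uE] := a5bar_gen_mod5; exists (sect 4 2 u).
rewrite -sectM_subst // subst_subst // uE sectD sect_nat sectM_subst //; congr (_ + _).
pose X := phi_pos; pose Y := psi∘q^2; pose Z := phi_pos∘q^25; pose T := psi∘q^50.
(* The product of phi(-q^25) = Z(q^4) - 2 q^25 T(q^4), phi(q) = X(q^4) + 2 q Y(q^4) and phi(q^2)^2 =
   X(q^4)^2 + 4 q^2 Y(q^4)^2, sorted by exponents modulo 4. *)
pose s := nth 0 [:: Z * X ^+ 3 - 16 * 'q ^+ 7 * T * Y ^+ 3;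
  2 * Z * Y * X ^+ 2 - 2 * 'q ^+ 6 * T * X ^+ 3;
  4 * Z * X * Y ^+ 2 - 4 * 'q ^+ 6 * T * Y * X ^+ 2;
  8 * Z * Y ^+ 3 - 8 * 'q ^+ 6 * T * Y ^+ 2 * X] : nat -> fps int.
have -> : phi_neg∘q^25 * phi_pos * phi_pos∘q^2 ^+ 2 =
    (s 0)∘q^4 + 'q * (s 1)∘q^4 + 'q ^+ 2 * (s 2)∘q^4 + 'q ^+ 3 * (s 3)∘q^4.
  rewrite phi_neg_dissect2 {2}phi_pos_dissect -substX // phi_pos_sqr.
  rewrite /s /X /Y /Z /T /=.
  by rewrite !(subst_nat, subst_q, substX, substM, substD, substN) // !subst_subst //; ring.
rewrite sect_dissect4 // /s /=.
transitivity (4 * ((phi_pos * phi_neg) * Y * (Z * Y - 'q ^+ 6 * T * X))).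
  by rewrite /X; ring.
by rewrite phi_pos_neg jacE substM // substX.
Qed.

Lemma a5bar_dvd5 r n : (r == 1%N) || (r == 3%N) -> (5 %| a5bar (20 * n + (4 * r + 2)))%Z.
Proof.
move=> r13; have r5 : (r < 5)%N by case/orP: r13 => /eqP ->.
have [u uE] := a5bar_gen_sect4.
have [p0 [p1 pE]] := psi_dissect5; have [j0 [j1 [j3 jE]]] := jac_dissect5.
pose k0 := phi_pos∘q^5 * p0∘q^2 - 2 * 'q ^+ 2 * psi∘q^10 * qtheta 5 4 one_wt.
pose k2 := phi_pos∘q^5 * p1∘q^2 - 2 * 'q * psi∘q^10 * qtheta 5 2 one_wt.
(* The two copies of q^6 phi(q^25) psi(q^50), whose exponents are 1 modulo 5, cancel. *)
have K : phi_pos∘q^25 * psi∘q^2 - 'q ^+ 6 * psi∘q^50 * phi_pos = k0∘q^5 + 'q ^+ 2 * k2∘q^5.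
  rewrite {1}pE {2}phi_pos_dissect5 /k0 /k2.
  by rewrite !(subst_nat, subst_q, substX, substM, substD, substN) // !subst_subst //; ring.
have J : jac∘q^2 = j0∘q^2∘q^5 + 'q ^+ 2 * j1∘q^2∘q^5 + 5 * j3∘q^2.
  by rewrite jE !(subst_nat, subst_q, substX, substM, substD) // !subst_subst.
pose s := nth 0 [:: j0∘q^2 * k0; 0; j0∘q^2 * k2 + j1∘q^2 * k0; 0; j1∘q^2 * k2] : nat -> fps int.
pose v := j3∘q^2 * (k0∘q^5 + 'q ^+ 2 * k2∘q^5).
have JK : jac∘q^2 * (k0∘q^5 + 'q ^+ 2 * k2∘q^5) =
    ((s 0)∘q^5 + 'q * (s 1)∘q^5 + 'q ^+ 2 * (s 2)∘q^5 +
     'q ^+ 3 * (s 3)∘q^5 + 'q ^+ 4 * (s 4)∘q^5) + 5 * v.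
  rewrite J /s /v /= !(substM, substD) // (subst_nat 0) //; ring.
have /(congr1 (fun t => t * phi_neg^-1)) : sect 5 r (sect 4 2 a5bar_gen) * phi_neg =
    5 * (4 * sect 5 r v + sect 5 r u).
  rewrite -sectM_subst // uE K JK sectD !sect_nat sectD sect_dissect5 // sect_nat.
  have -> : s r = 0 by case/orP: r13 => /eqP ->.
  ring.
rewrite mulrK ?phi_neg_unit // -mulrA => /fpsP/(_ n); rewrite fcoefMn !sectE => Gn.
rewrite /a5bar (_ : (20 * n + _ = 4 * (5 * n + r) + 2)%N); last by lia.
by rewrite Gn dvdz_mulr.
Qed.

(** * Parity and the solution of the recurrence *)

Lemma a5bar_dvd2 n : (0 < n)%N -> (2 %| a5bar n)%Z.
Proof.
move=> n0.
(* Modulo 2 the 5-dissection reads phi(-q) = phi(-q^25), so the index descends from m to m / 25. *)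
have f_even m : (0 < m)%N -> (2 %| phi_neg.[q^m])%Z.
  elim/ltn_ind: m => m IH m0; rewrite phi_neg_dissect -phi_neg5 subst_subst //.
  set x := _∘q^5; set y := _∘q^5.
  have -> : phi_neg∘q^25 - 2 * 'q * x + 2 * 'q ^+ 4 * y =
    phi_neg∘q^25 + 2 * ('q ^+ 4 * y - 'q * x) by ring.
  rewrite fcoefD fcoefMn; apply: rpredD; last exact: dvdz_mulr.
  rewrite [_.[q^m]]/=; case: ifP => // /dvdnP[k mk]; apply: IH; rewrite mk mulnK //; lia.
have [u uE] : exists u, phi_neg = 1 + 2 * u.
  exists (Fps (fun m => divz (phi_neg.[q^m] - (m == 0)%:R) 2)); apply/fpsP => m.
  rewrite fcoefD fcoefMn fcoef1 -[(Fps _).[q^m]]/(divz _ 2) mulrC divzK.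
    by rewrite addrC subrK.
  case: m => [|m]; last by rewrite subr0 f_even.
  by rewrite [phi_neg.[q^0]]/= big_mkcond big_ord1.
pose v := u∘q^5.
(* The polynomial in [v] is ((1 + 2 v)^5 - 1) / 2. *)
have : a5bar_gen = 1 + 2 * (5 * v + 20 * v ^+ 2 + 40 * v ^+ 3 + 40 * v ^+ 4 + 16 * v ^+ 5
                            - a5bar_gen * u).
  have := a5bar_genE; rewrite uE substD subst1 // substM // subst_nat // -/v => GE.
  transitivity (a5bar_gen * (1 + 2 * u) - 2 * (a5bar_gen * u)); first by ring.
  by rewrite GE; ring.
move=> /fpsP/(_ n); rewrite fcoefD fcoefMn fcoef1 eqn0Ngt n0 add0r /a5bar => ->.
exact: dvdz_mulr.
Qed.

Lemma a5bar_hecke5 n : a5bar (25 * n) = 6 * a5bar (5 * n) - 5 * a5bar n.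
Proof.
have /fpsP/(_ n) := a5bar_gen_hecke5.
by rewrite fcoefD fcoefN !fcoefMn !sectE !addn0 mulnA.
Qed.

(** The characteristic polynomial x^2 - 6 x + 5 has roots 1 and 5; the coefficients are fitted to k
    = 0 and k = 1, and the induction carries two consecutive cases. *)
Lemma a5bar_pow5 n k :
  4 * a5bar (5 ^ k * n) = 5 * a5bar n - a5bar (5 * n) + (5 ^ k)%N%:Z * (a5bar (5 * n) - a5bar n).
Proof.
have [] // : 4 * a5bar (5 ^ k * n) =
     5 * a5bar n - a5bar (5 * n) + (5 ^ k)%N%:Z * (a5bar (5 * n) - a5bar n) /\
   4 * a5bar (5 ^ k.+1 * n) =
     5 * a5bar n - a5bar (5 * n) + (5 ^ k.+1)%N%:Z * (a5bar (5 * n) - a5bar n).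
elim: k => [|k [IH1 IH2]]; first by rewrite expn0 expn1 mul1n; split; ring.
split=> //; rewrite (_ : (5 ^ k.+2 * n = 25 * (5 ^ k * n))%N); last by rewrite !expnS; ring.
rewrite a5bar_hecke5 mulnA -expnS.
transitivity (6 * (4 * a5bar (5 ^ k.+1 * n)) - 5 * (4 * a5bar (5 ^ k * n))); first by ring.
by rewrite IH1 IH2 !expnS !PoszM; ring.
Qed.

Theorem corollary3 (n k : nat) (hk : (2 <= k)%N) :
  [/\ (a5bar (20 * n + 6)%N = 0 %[mod 10])%Z,
      (a5bar (20 * n + 14)%N = 0 %[mod 10])%Z
    & (4 * a5bar (5 ^ k * n)%N = 5 * a5bar n - a5bar (5 * n)%N
         %[mod (5 ^ k)%N])%Z].
Proof.
split.
- have := a5bar_dvd2 (n := (20 * n + 6)%N); have := @a5bar_dvd5 1 n isT.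
  by rewrite addn_gt0 orbT => /dvdzP[x ->] /(_ isT) /dvdzP[y]; lia.
- have := a5bar_dvd2 (n := (20 * n + 14)%N); have := @a5bar_dvd5 3 n isT.
  by rewrite addn_gt0 orbT => /dvdzP[x ->] /(_ isT) /dvdzP[y]; lia.
by rewrite a5bar_pow5 addrC mulrC modzMDl.
Qed.
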